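(* Let $X$ be a nonempty set, $\Theta$ be a nonempty open interval of $\mathbb{R}$, and $\psi\in\Psi[T_n^{\boldsymbol{\lambda}}](X,\Theta)$ for some $n\in\mathbb{N}$ and $\boldsymbol{\lambda}=(\lambda_1,\ldots,\lambda_n)\in\Lambda_n$. Let $m\in\{1,\ldots,n\}$ and let $H_1,\dots,H_m$ be nonempty pairwise disjoint subsets of $\{1,\ldots,n\}$ such that $H_1\cup\cdots\cup H_m=\{1,\ldots,n\}$. For each $\alpha\in\{1,\ldots,m\}$, define $\mu_\alpha:=\sum_{i\in H_\alpha}\lambda_i$. Then $\boldsymbol{\mu}:=(\mu_1,\ldots,\mu_m)\in\Lambda_m$ and $\psi\in\Psi[T_m^{\boldsymbol{\mu}}](X,\Theta)$.
   Context: $\mathbb{N}$ is the set of positive integers; $\Lambda_n:=[0,\infty)^n\setminus\{(0,\ldots,0)\}$. Point of sign change: for $f:\Theta\to\mathbb{R}$, an element $\vartheta\in\Theta$ is a point of sign change (of decreasing type) for $f$ if $f(t)>0$ for all $t\in\Theta$ with $t<\vartheta$ and $f(t)<0$ for all $t\in\Theta$ with $t>\vartheta$. $\Psi(X,\Theta)$ is the class of functions $\psi:X\times\Theta\to\mathbb{R}$ such that for each $x\in X$ there exist $t_+,t_-\in\Theta$ with $t_+<t_-$ and $\psi(x,t_+)>0>\psi(x,t_-)$. For $\boldsymbol{\lambda}\in\Lambda_n$, $\psi\in\Psi[T_n^{\boldsymbol{\lambda}}](X,\Theta)$ means that $\psi\in\Psi(X,\Theta)$ and for every $(x_1,\ldots,x_n)\in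 X^n$ the function $\Theta\ni t\mapsto\sum_{i=1}^n\lambda_i\psi(x_i,t)$ has a point of sign change. *)

(* Defs.v *)
From mathcomp Require Import all_boot all_order all_algebra.
From mathcomp Require Import all_classical all_reals all_analysis.
Import Order.TTheory GRing.Theory Num.Theory.
Import numFieldNormedType.Exports.

Set Implicit Arguments.
Unset Strict Implicit.
Unset Printing Implicit Defensive.

Local Open Scope classical_set_scope.
Local Open Scope ring_scope.

(* A function on a subset Theta of R is a function on the subtype Theta (the
   coercion set_type), so there are no values outside Theta; \val embeds
   Theta into R. *)

Definition sign_change_point (R : realType) (Theta : set R)
    (f : Theta -> R) (v : Theta) : Prop :=
  (forall t : Theta, \val t < \val v -> 0 < f t) /\
  (forall t : Theta, \val v < \val t -> f t < 0).

Definition Lambda (R : realType) (n : nat) : set 'rV[R]_n :=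
  [set lam | (forall i, 0 <= lam 0 i) /\ lam <> 0].

Definition Psi (R : realType) (X : Type) (Theta : set R) :
    set (X -> Theta -> R) :=
  [set psi | forall x, exists tp tm : Theta,
     [/\ \val tp < \val tm, 0 < psi x tp & psi x tm < 0]].

(* Meaningful for lam in Lambda R n, which is a separate hypothesis. *)
Definition PsiT (R : realType) (X : Type) (Theta : set R) (n : nat)
    (lam : 'rV[R]_n) : set (X -> Theta -> R) :=
  [set psi | @Psi R X Theta psi /\
     forall x : 'I_n -> X, exists v : Theta,
       sign_change_point (fun t => \sum_(i < n) lam 0 i * psi (x i) t) v].

Arguments Lambda : clear implicits.
Arguments Psi {R} X Theta.
Arguments PsiT {R} X Theta {n} lam.

(* Main.v *)
Require Import Defs.
From mathcomp Require Import all_boot all_order all_algebra.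
From mathcomp Require Import all_classical all_reals all_analysis.
Import Order.TTheory GRing.Theory Num.Theory.
Import numFieldNormedType.Exports.

Local Open Scope classical_set_scope.
Local Open Scope ring_scope.

(** Assigning one point [x a] to every index of the block [H a] turns the
    [lam]-weighted sum of the [n] repeated points into the [mu]-weighted sum of
    the [m] points of [x], [mu a] being the total weight of [H a]. Every
    function that must have a point of sign change for [mu] is therefore one of
    the functions known to have such a point for [lam]. The vector [mu] is
    nonzero because a block sum of nonnegative weights vanishes only if all its
    terms do, and the blocks exhaust the indices. *)

Lemma sum_over_blocks (V : nmodType) (n m : nat) (H : 'I_m -> {set 'I_n})
    (H_disjoint : forall a b : 'I_m, a != b -> (H a :&: H b)%SET = finset.set0)
    (H_cover : (\bigcup_(a < m) H a)%SET = [set: 'I_n]%SET) (F : 'I_n -> V) :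
  \sum_(i < n) F i = \sum_(a < m) \sum_(i in H a) F i.
Proof.
rewrite -partition_disjoint_bigcup => [|a b ab].
  by rewrite H_cover; apply: eq_bigl => i; rewrite finset.in_setT.
by rewrite -setI_eq0 H_disjoint.
Qed.

(** The map needed to repeat points along blocks: composing a family indexed
    by blocks with it gives a family indexed by ['I_n], constant on each block.
    Covering provides a block for each index, disjointness makes it unique. *)
Lemma block_index_exists (n m : nat) (H : 'I_m -> {set 'I_n})
    (H_disjoint : forall a b : 'I_m, a != b -> (H a :&: H b)%SET = finset.set0)
    (H_cover : (\bigcup_(a < m) H a)%SET = [set: 'I_n]%SET) :
  exists block : 'I_n -> 'I_m, forall a i, i \in H a -> block i = a.
Proof.
have /choice[block iH] : forall i, exists a, i \in H a.
  move=> i; have : i \in (\bigcup_(a < m) H a)%SET.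
    by rewrite H_cover finset.in_setT.
  by case/finset.bigcupP => a _ ia; exists a.
exists block => a i ia; apply/eqP/negP => /negP /H_disjoint /finset.setP /(_ i).
by rewrite finset.in_setI iH ia finset.in_set0.
Qed.

Theorem proposition2p17 (R : realType) (X : Type) (X_nonempty : inhabited X)
    (Theta : set R) (Theta_nonempty : Theta !=set0)
    (Theta_open : open Theta) (Theta_interval : is_interval Theta)
    (n : nat) (n_gt0 : (0 < n)%N) (lam : 'rV[R]_n) (lam_in : Lambda R n lam)
    (psi : X -> Theta -> R) (psi_in : PsiT X Theta lam psi)
    (m : nat) (m_gt0 : (0 < m)%N) (m_le_n : (m <= n)%N)
    (H : 'I_m -> {set 'I_n})
    (H_nonempty : forall a : 'I_m, H a != finset.set0)
    (H_disjoint : forall a b : 'I_m, a != b -> (H a :&: H b)%SET = finset.set0)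
    (H_cover : (\bigcup_(a < m) H a)%SET = [set: 'I_n]%SET) :
  let mu : 'rV[R]_m := \row_(a < m) \sum_(i in H a) lam 0 i in
  Lambda R m mu /\ PsiT X Theta mu psi.
Proof.
move=> mu; case: lam_in => lam_ge0 lam_neq0; case: psi_in => psi_Psi lam_sign.
split; first split.
- by move=> a; rewrite mxE; apply: sumr_ge0 => i _; apply: lam_ge0.
(* The condition of being nonzero compares entry functions, not matrices, so
   equality is proved by function extensionality. *)
- move=> mu0; apply: lam_neq0; apply/funext => z; apply/funext => i.
  rewrite (ord1 z).
  have : i \in (\bigcup_(a < m) H a)%SET by rewrite H_cover finset.in_setT.
  case/finset.bigcupP => a _; move: i; apply: psumr_eq0P => //.
  by have := congr1 (fun w : 'I_1 -> 'I_m -> R => w 0 a) mu0; rewrite /= mxE.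
split=> // x; have [block blockE] := block_index_exists _ _ _ H_disjoint H_cover.
have repeatE t : \sum_(i < n) lam 0 i * psi (x (block i)) t =
    \sum_(a < m) mu 0 a * psi (x a) t.
  rewrite (sum_over_blocks _ _ _ _ H_disjoint H_cover); apply: eq_bigr => a _.
  by rewrite mxE mulr_suml; apply: eq_bigr => i /blockE ->.
have [v [v_pos v_neg]] := lam_sign (x \o block).
by exists v; split=> t tv; rewrite -repeatE; [apply: v_pos | apply: v_neg].
Qed.
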